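(* Let $E$ be a subspace of a real Banach lattice $X$, let $C\geq 1$ and $\varepsilon>0$. Then: (i) If $E$ does $C$-stable phase retrieval, then $E$ contains no $\frac{1}{C}$-almost disjoint pairs. (ii) If $E$ contains no $\varepsilon$-almost disjoint pairs, then $E$ does $\frac{2}{\varepsilon}$-stable phase retrieval. In particular, $E$ does stable phase retrieval if and only if it does not contain almost disjoint pairs.
   Context: ''Subspace'' means linear subspace (not necessarily closed or infinite dimensional). For $f$ in a Banach lattice, $|f| = f\vee(-f)$. A subspace $E$ of a (real) Banach lattice $X$ does $C$-stable phase retrieval if $\min_{\lambda\in\{1,-1\}}\|f-\lambda g\|\leq C\,\big\||f|-|g|\big\|$ for all $f,g\in E$; it does stable phase retrieval (SPR) if it does $C$-stable phase retrieval for some $C$. $E$ contains $\varepsilon$-almost disjoint pairs if there are $f,g\in E$ with $\|f\|=\|g\|=1$ and $\big\||f|\wedge|g|\big\|<\varepsilon$. $E$ contains almost disjoint pairs if it contains $\varepsilon$-almost disjoint pairs for every $\varepsilon>0$. *)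

(* Defs.v *)
From HB Require Import structures.
From mathcomp Require Import all_boot all_order all_algebra.
From mathcomp Require Import all_classical all_reals all_analysis.

Set Implicit Arguments.
Unset Strict Implicit.
Unset Printing Implicit Defensive.

Import Order.TTheory GRing.Theory Num.Theory.
Import numFieldNormedType.Exports.

Local Open Scope ring_scope.

(* A real vector space with a compatible lattice order.  Hierarchy-Builder
   rejects a structure joining Order.Lattice and GRing.Lmodule, because the
   later Num.RealDomain would have to inherit from it.  The order is therefore
   a field of the mixin, and the Order.Lattice structure is derived below. *)
HB.mixin Record isVectorLattice (R : realType) X of GRing.Lmodule R X := {
  vlat_le : rel X ;
  vlat_meet : X -> X -> X ;
  vlat_join : X -> X -> X ;
  vlat_lexx : reflexive vlat_le ;
  vlat_le_anti : antisymmetric vlat_le ;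
  vlat_le_trans : transitive vlat_le ;
  vlat_lexI : forall x y z : X,
    vlat_le x (vlat_meet y z) = vlat_le x y && vlat_le x z ;
  vlat_leUx : forall x y z : X,
    vlat_le (vlat_join x y) z = vlat_le x z && vlat_le y z ;
  vlat_leD2r : forall z x y : X, vlat_le x y -> vlat_le (x + z) (y + z) ;
  vlat_leZ2l : forall (a : R) (x y : X),
    0 <= a -> vlat_le x y -> vlat_le (a *: x) (a *: y)
}.

#[short(type="vectorLatticeType")]
HB.structure Definition VectorLattice (R : realType) :=
  {X of GRing.Lmodule R X & isVectorLattice R X}.

(* With display ring_display, [<=] in ring_scope denotes the order. *)
HB.instance Definition _ (R : realType) (X : vectorLatticeType R) :=
  Order.Le_isPOrder.Build ring_display (VectorLattice.sort X)
    vlat_lexx vlat_le_anti vlat_le_trans.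
HB.instance Definition _ (R : realType) (X : vectorLatticeType R) :=
  Order.POrder_isMeetSemilattice.Build ring_display (VectorLattice.sort X)
    vlat_lexI.
HB.instance Definition _ (R : realType) (X : vectorLatticeType R) :=
  Order.POrder_isJoinSemilattice.Build ring_display (VectorLattice.sort X)
    vlat_leUx.

(* The modulus |x|, an element of X; [`|x|] denotes the norm. *)
Definition modulus (R : realType) (X : vectorLatticeType R) (x : X) : X :=
  (x `|` - x)%O.

HB.mixin Record hasLatticeNorm (R : realType) X
    of VectorLattice R X & CompleteNormedModule R X := {
  blat_le_norm : forall x y : X,
    modulus x <= modulus y -> `|x| <= `|y|
}.

#[short(type="banachLatticeType")]
HB.structure Definition BanachLattice (R : realType) :=
  {X of VectorLattice R X & CompleteNormedModule R X & hasLatticeNorm R X}.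

HB.instance Definition _ (R : realType) (X : banachLatticeType R) :=
  Order.Lattice.copy (BanachLattice.sort X) (VectorLattice.sort X).

Section PhaseRetrieval.
Variables (R : realType) (X : banachLatticeType R).
Implicit Types (C eps : R) (E : {pred X}).

(* The two arguments of the minimum are the cases lambda = 1 and -1. *)
Definition stable_phase_retrieval_with C E :=
  forall f g : X, f \in E -> g \in E ->
    Num.min `|f - g| `|f + g| <= C * `|modulus f - modulus g|.

Definition stable_phase_retrieval E :=
  exists C : R, stable_phase_retrieval_with C E.

Definition has_eps_almost_disjoint_pairs eps E :=
  exists f g : X, [/\ f \in E, g \in E, `|f| = 1, `|g| = 1 &
    `|(modulus f `&` modulus g)%O| < eps].

Definition has_almost_disjoint_pairs E :=
  forall eps : R, 0 < eps -> has_eps_almost_disjoint_pairs eps E.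

End PhaseRetrieval.

(* Main.v *)
Require Import Defs.
From mathcomp Require Import all_boot all_order all_algebra.
From mathcomp Require Import all_classical all_reals all_analysis.

Import Order.TTheory GRing.Theory Num.Theory.
Import numFieldNormedType.Exports.

Local Open Scope ring_scope.

(** Everything rests on one identity, valid in every vector lattice:
    [| |f| - |g| | = |f + g| /\ |f - g|]  (lemma [modulus_subE]).
    It says that the error in the moduli of [f] and [g] is the overlap of
    [f + g] and [f - g], while the two quantities whose minimum stable phase
    retrieval controls are the norms of these same vectors.  The linear change
    of variables [(f, g) -> (f + g, f - g)] preserves the subspace [E], so it
    turns failures of stability into almost disjoint pairs and back.

    From an almost disjoint normalized pair [(f, g)], the vector [f + g] is at
    distance 2 from both [f - g] and [- (f - g)], whereas their moduli
    differ by [2 (|f| /\ |g|)], which is small.  Conversely, if [f, g] violate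
    the stability inequality, then normalizing [f + g] and [f - g] gives an
    almost disjoint pair: by positivity, the overlap of the normalized vectors
    is at most [| |f| - |g| |] divided by the smaller of the two norms
    (lemma [modulus_normalized_meet_le]).

    The identity itself is obtained by expanding [|f + g| /\ |f - g|] by
    distributivity into a join of four meets; each is a translate of [- |f|] or
    [- |g|], and they regroup into [(|f| - |g|) \/ (|g| - |f|)].  The
    distributivity of a vector lattice comes in turn from
    [x /\ y + x \/ y = x + y]. *)

(** * Vector lattices *)

Section VectorLatticeTheory.
Context {R : realType} {X : vectorLatticeType R}.
Implicit Types (x y z : X) (a b : R).

Lemma vlat_lerD2r z x y : (x + z <= y + z) = (x <= y).
Proof.
apply/idP/idP => [|]; last exact: vlat_leD2r.
by move=> /(@vlat_leD2r _ _ (- z)); rewrite !addrK.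
Qed.

Lemma vlat_lerBlDr x y z : (x - z <= y) = (x <= y + z).
Proof. by rewrite -[RHS](vlat_lerD2r (- z)) addrK. Qed.

Lemma vlat_lerD x y z t : x <= y -> z <= t -> x + z <= y + t.
Proof.
move=> xy zt; apply: (@le_trans _ _ (y + z)); first by rewrite vlat_lerD2r.
by rewrite ![y + _]addrC vlat_lerD2r.
Qed.

Lemma vlat_lerN2 x y : (- x <= - y) = (y <= x).
Proof. by rewrite -[LHS](vlat_lerD2r (x + y)) addKr [x + y]addrC addKr. Qed.

Lemma vlat_lerNr x y : (x <= - y) = (y <= - x).
Proof. by rewrite -[x in LHS]opprK vlat_lerN2. Qed.

Lemma vlat_joinDr x y z : ((x `|` y) + z = (x + z) `|` (y + z))%O.
Proof.
apply/le_anti/andP; split; last first.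
  by rewrite leUx !vlat_lerD2r leUl leUr.
rewrite -[z in X in X <= _]opprK vlat_lerBlDr leUx -!vlat_lerBlDr opprK.
by rewrite leUl leUr.
Qed.

Lemma vlat_oppU x y : (- (x `|` y) = - x `&` - y)%O.
Proof.
apply/le_anti/andP; split; first by rewrite lexI !vlat_lerN2 leUl leUr.
by rewrite -[leLHS]opprK vlat_lerN2 leUx vlat_lerNr leIl vlat_lerNr leIr.
Qed.

Lemma vlat_oppI x y : (- (x `&` y) = - x `|` - y)%O.
Proof. by rewrite -[RHS]opprK vlat_oppU !opprK. Qed.

Lemma vlat_meetDr x y z : ((x `&` y) + z = (x + z) `&` (y + z))%O.
Proof.
by rewrite -[LHS]opprK opprD vlat_oppI vlat_joinDr vlat_oppU !opprD !opprK.
Qed.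

Lemma vlat_meetE x y : (x `&` y = x + y - (x `|` y))%O.
Proof. by rewrite vlat_oppU addrC vlat_meetDr addKr addrC addrK meetC. Qed.

(** Writing a meet as a sum minus a join, the upper bound to be proved becomes
    an upper bound for [y \/ z], which can be checked on [y] and [z]
    separately. *)
Lemma vlat_meetUr x y z : (x `&` (y `|` z) = (x `&` y) `|` (x `&` z))%O.
Proof.
apply/le_anti/andP; split; last by rewrite leUx !leI2 ?leUl ?leUr.
rewrite [leLHS]vlat_meetE vlat_lerBlDr [x + _]addrC.
rewrite -[x in X in X <= _]opprK vlat_lerBlDr.
have key t : (t <= y `|` z -> x `&` t <= (x `&` y) `|` (x `&` z) ->
    t <= ((x `&` y) `|` (x `&` z)) + (x `|` (y `|` z)) - x)%O.
  move=> tyz tw; rewrite -vlat_lerBlDr opprK.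
  have -> : (t + x = (x `&` t) + (x `|` t))%O.
    by rewrite vlat_meetE subrK addrC.
  by apply: vlat_lerD => //; apply: leU2.
by rewrite leUx !key ?leUl ?leUr.
Qed.

Lemma vlat_meetUl x y z : ((y `|` z) `&` x = (y `&` x) `|` (z `&` x))%O.
Proof. by rewrite meetC vlat_meetUr ![(x `&` _)%O]meetC. Qed.

Lemma vlat_lerZ2l a x y : 0 < a -> (a *: x <= a *: y) = (x <= y).
Proof.
move=> a0; apply/idP/idP; last exact/vlat_leZ2l/ltW.
have ai : 0 <= a^-1 by rewrite invr_ge0 ltW.
by move=> /(vlat_leZ2l _ _ _ ai); rewrite !scalerA mulVf ?gt_eqF// !scale1r.
Qed.

Lemma vlat_lerZl a x y : 0 < a -> (a *: x <= y) = (x <= a^-1 *: y).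
Proof.
by move=> a0; rewrite -[RHS](vlat_lerZ2l a)// scalerA mulfV ?gt_eqF// scale1r.
Qed.

Lemma vlat_scaleU a x y : 0 < a -> (a *: (x `|` y) = (a *: x) `|` (a *: y))%O.
Proof.
move=> a0; apply/le_anti/andP; split; last first.
  by rewrite leUx !vlat_lerZ2l// leUl leUr.
by rewrite vlat_lerZl// leUx -!vlat_lerZl// leUl leUr.
Qed.

Lemma vlat_scaleI a x y : 0 < a -> (a *: (x `&` y) = (a *: x) `&` (a *: y))%O.
Proof. by move=> a0; rewrite !vlat_meetE scalerBr scalerDr vlat_scaleU. Qed.

(** * The modulus *)

Lemma modulusZ a x : 0 < a -> modulus (a *: x) = a *: modulus x.
Proof. by move=> a0; rewrite /modulus vlat_scaleU// scalerN. Qed.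

Lemma modulus_ge0 x : 0 <= modulus x.
Proof.
rewrite -(vlat_lerZ2l 2)// scaler0 scaler_nat mulr2n -[leLHS](subrr x).
by apply: vlat_lerD; rewrite ?leUl ?leUr.
Qed.

Lemma ge0_modulus x : 0 <= x -> modulus x = x.
Proof.
move=> x0; apply/join_idPl/(le_trans _ x0).
by rewrite -[leRHS]oppr0 vlat_lerN2.
Qed.

Lemma vlat_lerZ2r a b x : 0 <= x -> a <= b -> a *: x <= b *: x.
Proof.
move=> x0 ab; rewrite -[a *: x]add0r -[b](subrK a) scalerDl vlat_lerD2r.
by rewrite -(scaler0 _ (b - a)); apply: vlat_leZ2l; rewrite ?subr_ge0.
Qed.

(** Both sides are the join of the four vectors [x - |y|], [y - |x|],
    [- x - |y|] and [- y - |x|].  On the right they are the meets of a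
    candidate [+-(x + y)] with a candidate [+-(x - y)], since
    [v /\ -v = - |v|]. *)
Lemma modulus_subE x y :
  modulus (modulus x - modulus y) = (modulus (x + y) `&` modulus (x - y))%O.
Proof.
have meetE (u v : X) : ((u + v) `&` (u - v) = u - modulus v)%O.
  by rewrite ![u + _]addrC -vlat_meetDr /modulus vlat_oppU opprK meetC.
have -> : modulus (x + y) = ((x + y) `|` (- x - y))%O by rewrite /modulus opprD.
have -> : modulus (x - y) = ((x - y) `|` (y - x))%O by rewrite /modulus opprB.
rewrite vlat_meetUl !vlat_meetUr (meetE x y).
have -> : ((x + y) `&` (y - x) = y - modulus x)%O by rewrite -meetE [y + x]addrC.
have -> : ((- x - y) `&` (x - y) = - y - modulus x)%O.
  by rewrite -meetE meetC ![- y + _]addrC.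
have -> : ((- x - y) `&` (y - x) = - x - modulus y)%O.
  by rewrite -meetE meetC [- x + y]addrC.
rewrite [LHS]/modulus opprB ![modulus _ - _]vlat_joinDr joinACA.
by rewrite [(- x - _ `|` _)%O]joinC.
Qed.

(** Positivity of the moduli is what allows two different scalars to be
    replaced by a common upper bound. *)
Lemma modulus_meet_scale_le a b c x y : 0 < a <= c -> 0 < b <= c ->
  (modulus (a *: x) `&` modulus (b *: y))%O <= c *: (modulus x `&` modulus y)%O.
Proof.
move=> /andP[a0 ac] /andP[b0 bc].
rewrite vlat_scaleI ?(lt_le_trans a0)// !modulusZ//.
by apply: leI2; apply: vlat_lerZ2r => //; apply: modulus_ge0.
Qed.

End VectorLatticeTheory.

(** * Norm estimates in a Banach lattice *)

Section BanachLatticeTheory.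
Context {R : realType} {X : banachLatticeType R}.
Implicit Types (x y f g u v : X).

Lemma blat_le_norm_ge0 x y : 0 <= x -> x <= y -> `|x| <= `|y|.
Proof.
move=> x0 xy; apply: blat_le_norm.
by rewrite !ge0_modulus// (le_trans x0).
Qed.

Lemma norm_modulus x : `|modulus x| = `|x|.
Proof.
apply/le_anti/andP.
by split; apply: blat_le_norm; rewrite (ge0_modulus _ (modulus_ge0 x)).
Qed.

Lemma modulus_meet_ge0 x y : 0 <= (modulus x `&` modulus y)%O.
Proof. by rewrite lexI !modulus_ge0. Qed.

Lemma norm_modulus_sub f g :
  `|modulus f - modulus g| = `|(modulus (f + g) `&` modulus (f - g))%O|.
Proof. by rewrite -modulus_subE norm_modulus. Qed.

Lemma addDB f g : f + g + (f - g) = 2 *: f.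
Proof. by rewrite addrACA subrr addr0 scaler_nat mulr2n. Qed.

Lemma subDB f g : f + g - (f - g) = 2 *: g.
Proof. by rewrite opprB addrC addrA subrK scaler_nat mulr2n. Qed.

(** Taking sums and differences twice is multiplication by 2, so
    [norm_modulus_sub] at [f + g] and [f - g] measures the overlap of [f] and
    [g] themselves. *)
Lemma norm_modulus_subDB f g :
  `|modulus (f + g) - modulus (f - g)| = 2 * `|(modulus f `&` modulus g)%O|.
Proof.
rewrite norm_modulus_sub addDB subDB.
by rewrite !modulusZ// -vlat_scaleI// normrZ ger0_norm.
Qed.

Lemma modulus_normalized_meet_le u v : u != 0 -> v != 0 ->
  `|(modulus (`|u|^-1 *: u) `&` modulus (`|v|^-1 *: v))%O|
    <= (Num.min `|u| `|v|)^-1 * `|(modulus u `&` modulus v)%O|.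
Proof.
rewrite -!normr_gt0 => u0 v0.
have m0 : 0 < Num.min `|u| `|v| by rewrite lt_min u0.
have mV0 : 0 <= (Num.min `|u| `|v|)^-1 by rewrite invr_ge0 ltW.
rewrite -[X in X * _]ger0_norm// -normrZ.
apply: blat_le_norm_ge0; first exact: modulus_meet_ge0.
by apply: modulus_meet_scale_le; rewrite invr_gt0 lef_pV2 ?posrE// ge_min lexx
  ?orbT ?andbT.
Qed.

(** * Stable phase retrieval and almost disjoint pairs *)

(** The witnesses of instability are [f + g] and [f - g]: they differ, up to
    either sign, by [2 g] or [2 f], of norm 2. *)
Lemma spr_no_almost_disjoint (C : R) (E : {pred X}) :
  GRing.submod_closed E -> 0 < C -> stable_phase_retrieval_with C E ->
  ~ has_eps_almost_disjoint_pairs C^-1 E.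
Proof.
move=> hE C0 spr [f [g [Ef Eg nf ng small]]].
have [_ EB] := GRing.submod_closedB hE.
have [_ ED] := GRing.zmod_closedD (GRing.submod_closedB hE).
have := spr (f + g) (f - g) (ED _ _ Ef Eg) (EB _ _ Ef Eg).
rewrite addDB subDB norm_modulus_subDB !normrZ nf ng minxx mulr1 ger0_norm//.
rewrite mulrCA -[leLHS]mulr1 ler_pM2l// leNgt => /negP; apply.
by rewrite mulrC -ltr_pdivlMr// div1r.
Qed.

(** Where the stability inequality fails, its left side is positive, so [f + g]
    and [f - g] are nonzero and can be normalized; dividing the inequality by
    its left side bounds the overlap of the normalized vectors. *)
Lemma no_almost_disjoint_spr (eps : R) (E : {pred X}) :
  GRing.submod_closed E -> 0 < eps -> ~ has_eps_almost_disjoint_pairs eps E ->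
  stable_phase_retrieval_with (2 / eps) E.
Proof.
move=> hE e0 nad f g Ef Eg; rewrite leNgt; apply/negP => unstable.
have [_ EB] := GRing.submod_closedB hE.
have [_ ED] := GRing.zmod_closedD (GRing.submod_closedB hE).
set m := Num.min _ _ in unstable.
have m0 : 0 < m.
  by rewrite (le_lt_trans _ unstable)// mulr_ge0// divr_ge0// ltW.
have /andP[nB nD] : (0 < `|f - g|) && (0 < `|f + g|) by rewrite -lt_min.
have EZ a x : x \in E -> a *: x \in E.
  by move=> Ex; rewrite -[_ *: _]addr0; apply: hE.2 => //; exact: hE.1.
have normalized u : 0 < `|u| -> `| `|u|^-1 *: u| = 1.
  by move=> u0; rewrite normrZ gtr0_norm ?invr_gt0// mulVf ?gt_eqF.
apply: nad; exists (`|f - g|^-1 *: (f - g)), (`|f + g|^-1 *: (f + g)).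
split; [exact/EZ/EB|exact/EZ/ED|exact: normalized|exact: normalized|].
apply: (le_lt_trans (modulus_normalized_meet_le _ _ _ _)).
- by rewrite -normr_gt0.
- by rewrite -normr_gt0.
rewrite -/m meetC -norm_modulus_sub mulrC ltr_pdivrMr// -ltr_pdivrMl//.
(* Failure with the constant [1 / eps <= 2 / eps] already suffices. *)
apply: le_lt_trans unstable; apply: ler_wpM2r => //.
by rewrite ler_peMl ?invr_ge0 ?ler1n ?ltW.
Qed.

End BanachLatticeTheory.

Theorem theorem3p4 (R : realType) (X : banachLatticeType R) (E : {pred X})
    (hE : GRing.submod_closed E) :
  [/\ forall C : R, 1 <= C -> stable_phase_retrieval_with C E ->
        ~ has_eps_almost_disjoint_pairs C^-1 E,
      forall eps : R, 0 < eps -> ~ has_eps_almost_disjoint_pairs eps E ->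
        stable_phase_retrieval_with (2 / eps) E &
      stable_phase_retrieval E <-> ~ has_almost_disjoint_pairs E].
Proof.
split.
- by move=> C C1; apply: spr_no_almost_disjoint => //; apply: lt_le_trans C1.
- by move=> eps; apply: no_almost_disjoint_spr.
split=> [[C spr]|nad].
  (* A stability constant may be nonpositive, so it is first enlarged. *)
  have C0 : 0 < Num.max 1 C by rewrite lt_max ltr01.
  have spr' : stable_phase_retrieval_with (Num.max 1 C) E.
    move=> f g Ef Eg; apply: le_trans (spr f g Ef Eg) _.
    by rewrite ler_wpM2r// le_max lexx orbT.
  by move=> /(_ _ (etrans (invr_gt0 _) C0)); apply: spr_no_almost_disjoint.
have /existsNP[eps /not_implyP[e0 nade]] := nad.
by exists (2 / eps); apply: no_almost_disjoint_spr.
Qed.
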